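(* For every integer $n \geq 2$ there exists a constant $C_n > 0$, depending only on $n$, such that for every finite field $\mathbb{F}$, with $q = |\mathbb{F}|$ elements (of odd or even characteristic), there exists a Kakeya set in $\mathbb{F}^n$ of cardinality at most $2^{-(n-1)} \cdot q^n + C_n\, q^{n-1}$.
   Context: Let $\mathbb{F}$ be a finite field. A set $K \subseteq \mathbb{F}^n$ is called a Kakeya set in $\mathbb{F}^n$ if for every $\mathbf{b} \in \mathbb{F}^n$ there exists a point $\mathbf{a} \in \mathbb{F}^n$ such that for every $t \in \mathbb{F}$ the point $\mathbf{a} + t\cdot\mathbf{b}$ belongs to $K$. *)

(* Defs.v *)
From mathcomp Require Import all_boot all_order all_algebra.
From mathcomp Require Import reals.

Set Implicit Arguments.
Unset Strict Implicit.
Unset Printing Implicit Defensive.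

Import GRing.Theory.
Local Open Scope ring_scope.

(* The direction b = 0 is not excluded: it only forces K to be nonempty. *)
Definition kakeya_set (F : finFieldType) (n : nat) (K : {set 'rV[F]_n}) : Prop :=
  forall b : 'rV[F]_n, exists a : 'rV[F]_n, forall t : F, a + t *: b \in K.

(* Main.v *)
Require Import Defs.
From mathcomp Require Import all_boot all_order all_algebra.
From mathcomp Require Import reals.
From mathcomp Require Import zify ring.

(** With one coordinate [t] singled out, the line in direction [(1, b)] through
    [(0, b_i ^ 2)] consists of the points [(t, b_i ^ 2 + t b_i)].  These lie in
    the set of points [(t, x)] all of whose entries [x_i] are of the form
    [g ^ 2 + g t].  For [t != 0], in any characteristic, the map
    [g |-> g ^ 2 + g t] is invariant under [g |-> - t - g], which fixes at most
    one point, so it takes at most [(q + 1) / 2] values.  Adding the hyperplane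
    [t = 0] provides the remaining directions at a cost of [q ^ n.-1] points. *)

Import GRing.Theory Num.Theory.

Local Open Scope ring_scope.

Definition quad_values (F : finFieldType) (t : F) : {set F} :=
  [set g ^+ 2 + g * t | g in F].

Lemma card_quad_values (F : finFieldType) (t : F) :
  t != 0 -> (2 * #|quad_values F t| <= #|F| + 1)%N.
Proof.
move=> t0; pose f (g : F) := g ^+ 2 + g * t.
(* In characteristic 2 the inverse of [2] is the junk value [0], which is
   harmless: [g |-> - t - g] then has no fixed point. *)
pose g0 := - t / 2%:R.
have fixE (g : F) : g = - t - g -> g = g0.
  move=> gE; have g2 : g * 2%:R = - t by rewrite mulr_natr mulr2n {1}gE subrK.
  rewrite /g0 -g2 mulfK //; apply: contra_neq t0 => two0.
  by apply: oppr_inj; rewrite -g2 two0 mulr0 oppr0.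
have fE (g : F) : f (- t - g) = f g by rewrite /f; ring.
have fib1 : (0 < \sum_(g in F | f g == f g0) 1)%N.
  by rewrite sum1dep_card; apply/card_gt0P; exists g0; rewrite !inE eqxx.
have fib2 y : y \in f @: F -> y != f g0 -> (2 <= \sum_(g in F | f g == y) 1)%N.
  case/imsetP => g _ -> neq; rewrite sum1dep_card.
  rewrite -[2%N](_ : #|[set g; - t - g]| = 2%N).
    by apply/subset_leq_card/subsetP => z /set2P[] ->; rewrite !inE ?fE eqxx.
  by rewrite cards2; case: eqVneq => // /fixE gE; rewrite gE eqxx in neq.
have y0S : f g0 \in f @: F by apply: imset_f.
have -> : #|F| = (\sum_(y in f @: F) \sum_(g in F | f g == y) 1)%N.
  by rewrite -sum1_card (partition_big_imset f).
have -> : (2 * #|quad_values F t| = \sum_(y in f @: F) 2)%N.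
  by rewrite sum_nat_const mulnC.
(* Only the value [f g0] may lack a second preimage; this costs the [+ 1]. *)
rewrite !(bigD1 (f g0) y0S) /=.
rewrite addnAC addn1; apply: leq_add; first exact: fib1.
by apply: leq_sum => y /andP[]; exact: fib2.
Qed.

Definition kakeya_witness (F : finFieldType) (m : nat) : {set 'rV[F]_m.+1} :=
  [set x : 'rV[F]_m.+1 | (x ord0 ord0 == 0) ||
           [forall i, x ord0 (lift ord0 i) \in quad_values F (x ord0 ord0)]].

Lemma kakeya_witnessP (F : finFieldType) (m : nat) :
  kakeya_set (kakeya_witness F m).
Proof.
move=> b; have [b0|b0] := eqVneq (b ord0 ord0) 0.
  by exists 0 => t; rewrite inE !mxE b0 mulr0 addr0 eqxx.
(* Rescaling the direction to first entry 1 turns the parameter into [t * b ord0 ord0], the first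
   coordinate of the point. *)
pose c i := b ord0 i / b ord0 ord0.
exists (\row_i (if i == ord0 then 0 else c i ^+ 2)) => t.
rewrite inE; apply/orP; right; apply/forallP => i; rewrite !mxE /= add0r.
apply/imsetP; exists (c (lift ord0 i)) => //; congr (_ + _).
by rewrite mulrCA /c divfK.
Qed.

Lemma card_row_slice (F : finFieldType) (m : nat) (t : F) (S : {set F}) :
  #|[set x : 'rV[F]_m.+1 |
      (x ord0 ord0 == t) && [forall i, x ord0 (lift ord0 i) \in S]]| = (#|S| ^ m)%N.
Proof.
pose G (i : 'I_m.+1) : {set F} := if i == ord0 then [set t] else S.
have -> : (#|S| ^ m)%N = #|family (fun i => mem (G i))|.
  rewrite card_family foldrE big_map -[LHS]mul1n.
  rewrite big_enum /= big_ord_recl /G eqxx cards1.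
  by rewrite (eq_bigr (fun=> #|S|)) // prod_nat_const card_ord.
pose h (x : 'rV[F]_m.+1) : {ffun 'I_m.+1 -> F} := [ffun i => x ord0 i].
have h_inj : injective h.
  by move=> x y /ffunP e; apply/rowP => i; have := e i; rewrite !ffunE.
rewrite -(card_imset _ h_inj); apply: eq_card => f; apply/imsetP/familyP.
  case=> x; rewrite inE => /andP[/eqP x0 /forallP xS] -> i; rewrite ffunE /G.
  by case: (unliftP ord0 i) => [j|] -> //=; rewrite inE x0.
move=> fG; exists (\row_i f i); last by apply/ffunP => i; rewrite ffunE mxE.
rewrite inE mxE; apply/andP; split.
  by have := fG ord0; rewrite /G eqxx inE.
by apply/forallP => i; rewrite mxE; have := fG (lift ord0 i); rewrite /G.
Qed.

(** In the binomial expansion of [(q + 1) ^ m], the terms below [q ^ m] have coefficients summing to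
    [2 ^ m - 1] and powers of [q] at most [q ^ (m - 1)]. Induction replaces the expansion. *)
Lemma mul_exp_succ_le (q m : nat) : (0 < q)%N ->
  (q * (q + 1) ^ m + q ^ m <= q ^ m.+1 + 2 ^ m * q ^ m)%N.
Proof.
move=> q0; elim: m => [|m IH]; first by rewrite !expn0; lia.
have := expn_gt0 2 m; rewrite !expnS in IH *.
move: ((q + 1) ^ m)%N (q ^ m)%N (2 ^ m)%N IH => a b c IH c0.
case: q q0 IH => // q _ IH; case: c c0 IH => // c _ IH.
have : (q.+2 * (q.+1 * a) <= q.+2 * (q.+1 * b + c * b))%N.
  by rewrite leq_mul2l; lia.
(* After the shifts [q] and [c] stand for the original values minus 1; this product is exactly the
   slack left by the induction hypothesis times [q.+2]. *)
have : (0 <= c * q * b)%N by [].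
nia.
Qed.

Lemma card_kakeya_witness (F : finFieldType) (m : nat) :
  (2 ^ m * #|kakeya_witness F m| <= #|F| ^ m.+1 + 2 ^ m * 2 * #|F| ^ m)%N.
Proof.
set q := #|F|.
pose S (t : F) : {set F} := if t == 0 then [set: F] else quad_values F t.
have -> : #|kakeya_witness F m| = (\sum_(t : F) #|S t| ^ m)%N.
  rewrite -sum1_card (partition_big (fun x : 'rV_m.+1 => x ord0 ord0) predT) //=.
  apply: eq_bigr => t _; rewrite sum1dep_card -(card_row_slice F m t (S t)).
  apply: eq_card => x; rewrite !inE andbC; have [<-|//] := eqVneq (x ord0 ord0) t.
  rewrite /S; case: eqP => //= _; apply/esym/forallP => i; exact: in_setT.
rewrite (bigD1 0) //= {1}/S eqxx cardsT -/q mulnDr big_distrr /=.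
have bnd : (\sum_(t : F | t != 0%R) 2 ^ m * #|S t| ^ m <= q * (q + 1) ^ m)%N.
  (* The slice [t = 0] is allotted a term as well, giving [q] equal terms. *)
  rewrite -sum_nat_const big_mkcond; apply: leq_sum => t _.
  case: ifP => // t0; rewrite /S (negPf t0) -expnMn.
  case: (posnP m) => [->|m0]; first by rewrite !expn0.
  by rewrite leq_exp2r // card_quad_values.
have q0 : (0 < q)%N by apply/card_gt0P; exists 0.
apply: leq_trans (leq_add (leqnn _) bnd) _.
have := mul_exp_succ_le q m q0; nia.
Qed.

Theorem theorem8 (R : realType) (n : nat) (hn : (2 <= n)%N) :
  exists C : R, 0 < C /\
    forall F : finFieldType, exists K : {set 'rV[F]_n},
      kakeya_set K /\
      (#|K|%:R : R) <= 2 ^- n.-1 * #|F|%:R ^+ n + C * #|F|%:R ^+ n.-1.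
Proof.
(* Of the constant 2, one unit pays for the hyperplane, the other for the excess of
   [q * (q + 1) ^ m] over [q ^ m.+1]. *)
case: n hn => // m _; exists 2; split=> // F.
exists (kakeya_witness F m); split; first exact: kakeya_witnessP.
have p2 : (0 : R) < 2 ^+ m by rewrite exprn_gt0.
rewrite /= -(ler_pM2l p2) mulrDr (mulVKf (lt0r_neq0 p2)) mulrA.
by rewrite -!natrX -!natrM -natrD ler_nat card_kakeya_witness.
Qed.
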